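(* Let $S$ be an ordered semigroup without zero element. Then $S$ is completely regular if and only if it is a complete semilattice of completely simple ordered semigroups.
   Context: An ordered semigroup $(S,\cdot,\le)$ is a semigroup $(S,\cdot)$ that is a poset $(S,\le)$ such that $a\le b$ implies $ca\le cb$ and $ac\le bc$ for all $a,b,c\in S$. A zero element is an element $0$ with $0x=x0=0$ and $0\le x$ for all $x\in S$. For $H\subseteq S$, $(H]=\{t\in S: t\le h \text{ for some } h\in H\}$. $S$ is completely regular if $a\in(a^2Sa^2]$ for every $a\in S$. A nonempty $I\subseteq S$ is an ideal if $SI\subseteq I$, $IS\subseteq I$ and $(I]\subseteq I$; $S$ is simple if it contains no proper ideal. An ordered semigroup is completely simple if it is simple and completely regular. A congruence on $S$ is an equivalence relation $\rho$ such that $a\,\rho\,b$ implies $ca\,\rho\,cb$ and $ac\,\rho\,bc$ for all $c\in S$. It is a semilattice congruence if $a\,\rho\,a^2$ and $ab\,\rho\,ba$ for all $a,b\in S$, and a complete semilattice congruence if moreover $a\le b$ implies $a\,\rho\,ab$. $S$ is a complete semilattice of (sub)semigroups of type $\tau$ if there is a complete semilattice congruence $\rho$ on $S$ such that every $\rho$-class is a subsemigroup of $S$ of type $\tau$ (with the induced order). *)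

(* Defs.v *)
From HB Require Import structures.
From mathcomp Require Import all_boot all_order classical_sets.

Set Implicit Arguments.
Unset Strict Implicit.
Unset Printing Implicit Defensive.

Import Order.TTheory.

Local Open Scope group_scope.
Local Open Scope order_scope.
Local Open Scope classical_set_scope.

HB.mixin Record isOrderedSemigroup (d : Order.disp_t) S
    of Semigroup S & Order.POrder d S := {
  lemul2l : forall c a b : S, a <= b -> c * a <= c * b;
  lemul2r : forall c a b : S, a <= b -> a * c <= b * c
}.

#[short(type="orderedSemigroupType")]
HB.structure Definition OrderedSemigroup (d : Order.disp_t) :=
  { S of Semigroup S & Order.POrder d S & isOrderedSemigroup d S }.

Section OrderedSemigroupDefs.
Context (d : Order.disp_t) (S : orderedSemigroupType d).

Definition is_zero (z : S) : Prop :=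
  (forall x, z * x = z /\ x * z = z) /\ (forall x, z <= x).

Definition has_zero : Prop := exists z : S, is_zero z.

(* Written (H] in the literature. *)
Definition downset (H : set S) : set S :=
  [set t | exists2 h, H h & t <= h].

Definition completely_regular : Prop :=
  forall a : S, downset [set a * a * s * (a * a) | s in [set: S]] a.

Definition is_ideal (I : set S) : Prop :=
  [/\ I !=set0,
      forall s x, I x -> I (s * x),
      forall s x, I x -> I (x * s)
    & downset I `<=` I].

Definition is_simple : Prop :=
  forall I : set S, is_ideal I -> I = [set: S].

Definition completely_simple : Prop := is_simple /\ completely_regular.

Definition is_congruence (rho : rel S) : Prop :=
  equivalence_rel rho /\
  forall a b c : S, rho a b -> rho (c * a) (c * b) /\ rho (a * c) (b * c).

Definition is_semilattice_congruence (rho : rel S) : Prop :=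
  [/\ is_congruence rho,
      forall a : S, rho a (a * a)
    & forall a b : S, rho (a * b) (b * a)].

Definition is_complete_semilattice_congruence (rho : rel S) : Prop :=
  is_semilattice_congruence rho /\ forall a b : S, a <= b -> rho a (a * b).

End OrderedSemigroupDefs.

Arguments has_zero {d} S.
Arguments completely_regular {d} S.
Arguments is_simple {d} S.
Arguments completely_simple {d} S.

(* The closure proof is a parameter of the type so that the ordered semigroup
   structure can be inferred from the type alone. *)
Definition subsemigroup_type (d : Order.disp_t) (S : orderedSemigroupType d)
  (A : pred S) (mulA : mulg_closed A) : Type := {x : S | A x}.

Section Subsemigroup.
Context (d : Order.disp_t) (S : orderedSemigroupType d).
Context (A : pred S) (mulA : mulg_closed A).

Local Notation U := (subsemigroup_type mulA).

HB.instance Definition _ := SubChoice.on U.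
HB.instance Definition _ :=
  SubChoice_isSubSemigroup.Build S A U mulA.
HB.instance Definition _ := [SubChoice_isSubPOrder of U by <: with d].

Fact subsemigroup_lemul2l (c a b : U) : a <= b -> c * a <= c * b.
Proof. by rewrite -!Order.le_val !valM; apply: lemul2l. Qed.

Fact subsemigroup_lemul2r (c a b : U) : a <= b -> a * c <= b * c.
Proof. by rewrite -!Order.le_val !valM; apply: lemul2r. Qed.

HB.instance Definition _ :=
  isOrderedSemigroup.Build d U subsemigroup_lemul2l subsemigroup_lemul2r.

End Subsemigroup.

(* A type of ordered semigroups is represented by a predicate [tau]. The class
   of [a] is the predicate [rho a]; it contains [a], so it is not empty. *)
Definition complete_semilattice_of (d : Order.disp_t)
    (tau : orderedSemigroupType d -> Prop) (S : orderedSemigroupType d) : Prop :=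
  exists2 rho : rel S, is_complete_semilattice_congruence rho &
    forall a : S, exists mulA : mulg_closed (rho a),
      tau (subsemigroup_type mulA : orderedSemigroupType d).

(* Main.v *)
Require Import Defs.
From mathcomp Require Import all_boot all_order classical_sets.
From mathcomp Require Import boolp.

(** The congruence is Green's relation J. In a completely regular [S] each [a]
    lies below a product containing [a] as an inner factor, so the ideal
    generated by [b] is the set of all [t] below some [x * b * y], and
    inclusion of principal ideals is the relation [green_le] below.

    Everything rests on two facts. A product is [green_le] each of its factors
    ([green_le_mull], [green_le_mulr]), and [a] is [green_le] its square
    ([green_le_sqr]). Since [(a * b) * (a * b)] contains [b * a] as a block, it
    follows that products commute up to J ([green_leC]); commuting and dropping
    factors then shows that [green_le] is compatible with multiplication, and
    that J is a complete semilattice congruence.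

    It remains to see that a J-class is completely simple by itself. The
    witnesses of divisibility live in [S], and have to be moved into the class.
    The device is the same in both cases: use regularity to write [a] below a
    product of factors each of which contains an element of the class. Such a
    factor is [green_le] that element, and [a] is [green_le] the factor because
    it is below the product; hence the factor is in the class
    ([class_regular], [class_divides]).

    Conversely, a regularity witness for [a] inside its class is one in [S]. *)

Set Implicit Arguments.
Unset Strict Implicit.
Unset Printing Implicit Defensive.

Import Order.TTheory.

Local Open Scope group_scope.
Local Open Scope order_scope.
Local Open Scope classical_set_scope.

Lemma completely_regularP (d : Order.disp_t) (S : orderedSemigroupType d) :
  completely_regular S <-> forall a : S, exists s, a <= a * a * s * (a * a).
Proof.
split=> reg a; first by have [_ [s _ <-] le_a] := reg a; exists s.
by have [s le_a] := reg a; exists (a * a * s * (a * a)) => //; exists s.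
Qed.

Section GreenJ.
Context (d : Order.disp_t) (S : orderedSemigroupType d).
Implicit Types a b c p s t u v x y z : S.

Lemma lemul a b x y : a <= b -> x <= y -> a * x <= b * y.
Proof.
by move=> le_ab le_xy; apply: (le_trans (lemul2l a _ _ le_xy)); apply: lemul2r.
Qed.

(** For completely regular [S], [a] lies in the ideal generated by [b]; the
    factors [x] and [y] need no adjoined identity because then
    [b <= b * b * s * (b * b)]. *)
Definition green_le a b : Prop := exists x y, a <= x * b * y.

Definition green_eq a b : Prop := green_le a b /\ green_le b a.

Lemma green_le_trans b a c : green_le a b -> green_le b c -> green_le a c.
Proof.
move=> [x [y le_a]] [x' [y' le_b]]; exists (x * x'), (y' * y).
apply: (le_trans le_a); rewrite -!mulgA; apply: lemul2l.
by rewrite !mulgA in le_b *; apply: lemul2r.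
Qed.

Lemma le_green_le_trans b a c : a <= b -> green_le b c -> green_le a c.
Proof. by move=> le_ab [x [y le_b]]; exists x, y; apply: le_trans le_b. Qed.

Lemma green_le_block x b y : green_le (x * b * y) b.
Proof. by exists x, y. Qed.

Lemma green_eq_sym a b : green_eq a b -> green_eq b a.
Proof. by case. Qed.

Lemma green_eq_trans b a c : green_eq a b -> green_eq b c -> green_eq a c.
Proof.
by move=> [ab ba] [bc cb]; split; [apply: green_le_trans bc
                                  | apply: green_le_trans ba].
Qed.

Hypothesis regular : forall a, exists s, a <= a * a * s * (a * a).

Lemma green_le_refl a : green_le a a.
Proof. by have [s le_a] := regular a; exists a, (s * (a * a)); rewrite mulgA. Qed.

Lemma green_eq_refl a : green_eq a a.
Proof. by split; apply: green_le_refl. Qed.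

Lemma green_le_mull x a : green_le (x * a) a.
Proof.
have [u [v le_a]] := green_le_refl a; exists (x * u), v.
by rewrite -!mulgA; apply: lemul2l; rewrite mulgA.
Qed.

Lemma green_le_mulr a x : green_le (a * x) a.
Proof.
have [u [v le_a]] := green_le_refl a; exists u, (v * x).
by rewrite mulgA; apply: lemul2r.
Qed.

Lemma green_le_sqr a : green_le a (a * a).
Proof.
have [s le_a] := regular a; apply: (le_green_le_trans le_a).
by rewrite -mulgA; apply: green_le_mulr.
Qed.

(** [(a * b) * (a * b)] is [a * (b * a) * b]. *)
Lemma green_leC a b : green_le (a * b) (b * a).
Proof.
apply: (green_le_trans (green_le_sqr (a * b))).
by exists a, b; rewrite !mulgA.
Qed.

Lemma green_le_mul2l c a b : green_le a b -> green_le (c * a) (c * b).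
Proof.
move=> [x [y le_a]]; apply: (le_green_le_trans (lemul2l c _ _ le_a)).
(* Rotate [c] to the end, drop [x], rotate [b] to the end, drop [y]. *)
apply: (green_le_trans (green_leC _ _)); rewrite -!mulgA.
apply: (green_le_trans (green_le_mull _ _)).
apply: (green_le_trans (green_leC _ _)); rewrite -mulgA.
exact: green_le_mull.
Qed.

Lemma green_le_mul2r c a b : green_le a b -> green_le (a * c) (b * c).
Proof.
move=> le_ab; apply: (green_le_trans (green_leC _ _)).
by apply: (green_le_trans (green_le_mul2l c le_ab)); apply: green_leC.
Qed.

Lemma green_eq_sqr a : green_eq a (a * a).
Proof. by split; [apply: green_le_sqr | apply: green_le_mull]. Qed.

Lemma green_eq_mul_closed a x y :
  green_eq a x -> green_eq a y -> green_eq a (x * y).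
Proof.
move=> [ax xa] [ay ya]; apply: (green_eq_trans (green_eq_sqr a)); split.
- exact: green_le_trans (green_le_mul2r a ax) (green_le_mul2l x ay).
- exact: green_le_trans (green_le_mul2r y xa) (green_le_mul2l a ya).
Qed.

(** A regularity witness for [a] can be taken in the J-class of [a]: replacing
    the inner [a] on each side of [s] by its regular bound puts copies of [a]
    around [s]. *)
Lemma class_regular a :
  exists2 t, green_eq a t & a <= a * a * t * (a * a).
Proof.
have [s le_a] := regular a.
pose t := a * s * a * a * s * a * a * s * a.
have le_at : a <= a * a * t * (a * a).
  apply: (le_trans le_a).
  have -> : a * a * t * (a * a)
      = (a * (a * a * s * (a * a))) * s * ((a * a * s * (a * a)) * a).
    by rewrite /t !mulgA.
  by apply: lemul; [apply/lemul2r/lemul2l | apply: lemul2r].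
exists t => //; split; last exact: green_le_mull.
exact: le_green_le_trans le_at (green_le_block _ _ _).
Qed.

(** J-equivalent elements divide each other inside their class: when
    [y <= u * x * v], flanking [u] and [v] by copies of [y] makes them
    [green_le] [y]. *)
Lemma class_divides x y : green_le y x ->
  exists p q, [/\ green_eq y p, green_eq y q & y <= p * x * q].
Proof.
move=> [u [v le_y]]; have [s le_yy] := regular y.
exists (y * u), (v * s * (y * y)).
have le_pxq : y <= y * u * x * (v * s * (y * y)).
  apply: (le_trans le_yy).
  have -> : y * u * x * (v * s * (y * y)) = y * (u * x * v) * s * (y * y).
    by rewrite !mulgA.
  by do 2!apply: lemul2r; apply: lemul2l.
split=> //; split; try exact: green_le_mulr.
- by apply: (le_green_le_trans le_pxq); rewrite -mulgA; apply: green_le_mulr.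
- by apply: (le_green_le_trans le_pxq); apply: green_le_mull.
- by rewrite mulgA; apply: green_le_mull.
Qed.

Definition greenb : rel S := fun a b => `[< green_eq a b >].

Lemma greenb_complete : is_complete_semilattice_congruence greenb.
Proof.
split; first split; first split.
- move=> x y z; split=> [|/asboolP xy]; first by apply/asboolP/green_eq_refl.
  apply/asboolP/asboolP; last exact: green_eq_trans.
  exact: green_eq_trans (green_eq_sym xy).
- move=> a b c /asboolP[ab ba]; split; apply/asboolP; split;
    by [apply: green_le_mul2l | apply: green_le_mul2r].
- by move=> a; apply/asboolP/green_eq_sqr.
- by move=> a b; apply/asboolP; split; apply: green_leC.
(* [a <= b] bounds [a * a], which [a] is below in J, by [a * b]. *)
- move=> a b le_ab; apply/asboolP; split; last exact: green_le_mulr.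
  have [x [y le_a]] := green_le_sqr a; exists x, y.
  by apply: (le_trans le_a); apply/lemul2r/lemul2l/lemul2l.
Qed.

Lemma greenb_mul_closed a : mulg_closed (greenb a).
Proof.
by move=> x y /asboolP ax /asboolP ay; apply/asboolP/green_eq_mul_closed.
Qed.

Lemma green_class_completely_simple a :
  completely_simple
    (subsemigroup_type (@greenb_mul_closed a) : orderedSemigroupType d).
Proof.
split=> [I [[x Ix] Il Ir Idown]|].
  apply/seteqP; split=> // y _.
  have [/asboolP ax /asboolP ay] := (valP x, valP y).
  have [yx _] := green_eq_trans (green_eq_sym ay) ax.
  have [p [q [yp yq le_y]]] := class_divides yx.
  have ap : greenb a p by apply/asboolP/(green_eq_trans ay).
  have aq : greenb a q by apply/asboolP/(green_eq_trans ay).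
  apply: Idown; exists (Sub p ap * x * Sub q aq); first exact/Ir/Il.
  by rewrite -Order.le_val.
apply/completely_regularP => x; have /asboolP ax := valP x.
have [t xt le_x] := class_regular (val x).
have at_ : greenb a t by apply/asboolP/(green_eq_trans ax).
by exists (Sub t at_); rewrite -Order.le_val.
Qed.

End GreenJ.

Theorem theorem4p14 (d : Order.disp_t) (S : orderedSemigroupType d)
  (no_zero : ~ has_zero S) :
  completely_regular S <-> complete_semilattice_of (@completely_simple d) S.
Proof.
split=> [/completely_regularP regular | [rho [[[rho_eq _] _ _] _] rho_cs]].
  exists (@greenb d S); first exact: greenb_complete.
  move=> a; exists (greenb_mul_closed regular (a := a)).
  exact: green_class_completely_simple.
apply/completely_regularP => a.
have [mulA [_ /completely_regularP reg]] := rho_cs a.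
have [s le_a] := reg (Sub a (rho_eq a a a).1).
by exists (val s); rewrite -Order.le_val in le_a.
Qed.
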